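(* Let $G$ be an arbitrary group and let $a\in G$ be such that both $a\in L_4(G)$ and $a^{-1}\in L_4(G)$. Then $\langle a,a^b\rangle$ is nilpotent of class at most $4$ for all $b\in G$.
   Context: For elements $a,b$ of a group, $a^b := b^{-1}ab$, $[a,b]:=a^{-1}b^{-1}ab$, and the Engel commutators are defined inductively by $[a,_0 b]:=a$ and $[a,_n b]:=[[a,_{n-1} b],b]$ for $n>0$. An element $x\in G$ is left $n$-Engel if $[g,_n x]=1$ for all $g\in G$; $L_n(G)$ denotes the set of all left $n$-Engel elements of $G$. *)

(* Defs.v *)
From mathcomp Require Import all_boot classical_sets.

Set Implicit Arguments.
Unset Strict Implicit.
Unset Printing Implicit Defensive.

Local Open Scope classical_set_scope.
Local Open Scope group_scope.

(* Subsets of a possibly infinite group are Prop-valued, so that no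
   decidability of membership is presupposed. *)

Section EngelNilpotent.
Variable G : groupType.
Implicit Types (A H : set G) (n c : nat).

(* [a ,_n b] *)
Fixpoint engel_commg (a b : G) n : G :=
  if n is m.+1 then [~ engel_commg a b m, b] else a.

(* L_n(G) *)
Definition left_engel n : set G :=
  [set x | forall g : G, engel_commg g x n = 1].

Definition subgroup H : Prop :=
  [/\ H 1, forall x y, H x -> H y -> H (x * y) & forall x, H x -> H x^-1].

Definition generated A : set G := smallest subgroup A.

(* The lower central series of H, indexed from 0: [lower_central H n] is
   usually written gamma_(n+1)(H), so gamma_1(H) = H. *)
Fixpoint lower_central H n : set G :=
  if n is m.+1 then generated [set [~ x, y] | x in lower_central H m & y in H]
  else H.

Definition nilpotent_class_le c H : Prop := lower_central H c = [set 1].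

End EngelNilpotent.

Arguments left_engel : clear implicits.

(* Main.v *)
Require Import Defs.
From mathcomp Require Import all_boot classical_sets.

(** Let X be the set of all conjugates of a and of a^-1.

    The two Engel conditions on a enter only through one consequence
    ([left_engel4_conj_nil2]): for u, v in X the subgroup <u, u^v> has class
    at most 2.  Unwinding [g, v, v, v, v] twice turns it into a conjugate of
    [v^-u, v, v] with u a conjugate of v^-1, which says that [v^-u, v] commutes
    with v; the same for v^-1 says, after a conjugation, that this commutator
    also commutes with v^u.

    Now let x, y be in X and look at the orbit x, x1 = x^y, x2 = x1^y of x.
    Put c = [x, y], d = [x, y, x], c1 = c^y and d1 = d^y.  Then x1 = x c and
    x2 = x1 c1.  Class 2 for <x, x^y> and for <y, y^x> says that c and c1
    commute, that d is central in <x, x1>, and that the orbit of c under y is a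
    geometric progression: c1^y = c1 c^-1 c1.

    The aim is that [x, y, x, y] = d^-1 d1 is central in <x, y>.  The defects
    are p = [d1, x] and q = [d, x2].  Class 2 for <x, x^x2> and for <x, x^y'>,
    with y' a suitable conjugate of y, shows that p commutes with x, d and d1
    ([defect_commute]); reversing the orbit, that q commutes with x2, d and d1.  Then
    w = q p turns out to equal [d1, d] and to be central in the group generated
    by the orbit, and c1^y = c1 c^-1 c1 yields
    d1^y = d1 (w p)^2 (d q)^-1 d1.  But d1^y commutes with x2, which forces
    q = 1, and then w and p vanish too ([progression_collapse]).  So d1 commutes
    with x, and d1^y = d1 d^-1 d1, that is, d^-1 d1 is fixed by y.

    By symmetry [y, x, y, x] is central as well.  Climbing the upper central
    series of H = <x, y> from there, [x, y, x] and [y, x, y] lie in its second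
    term, [x, y] in the third, x and y in the fourth, so that H has class at
    most 4.  The theorem is the case x = a, y = a^b. *)

Local Open Scope classical_set_scope.
Local Open Scope group_scope.

(** * Commutation and conjugation *)

Section Commutation.
Set Implicit Arguments.
Unset Strict Implicit.
Variable G : groupType.
Implicit Types u v w x y z : G.

Lemma conjg_commute x y : commute x y <-> x ^ y = x.
Proof. by split=> [/commgP/conjg_fixP //|/conjg_fixP/commgP]. Qed.

Lemma commuteJ u v z : commute u v -> commute (u ^ z) (v ^ z).
Proof. by rewrite /commute -!conjMg => ->. Qed.

Lemma commuteJK u v z : commute (u ^ z) (v ^ z) -> commute u v.
Proof. by rewrite /commute -!conjMg => /conjg_inj. Qed.

Lemma commuteVl u v : commute u v -> commute u^-1 v.
Proof. by move=> /commute_sym/commuteV/commute_sym. Qed.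

Lemma commuteMl u v w : commute u w -> commute v w -> commute (u * v) w.
Proof. by move=> /commute_sym ? /commute_sym ?; apply/commute_sym/commuteM. Qed.

Lemma conjgg x : x ^ x = x. Proof. exact: mulKg. Qed.

Lemma commMgJ u v w : [~ u * v, w] = [~ u, w] ^ v * [~ v, w].
Proof. by rewrite /commg /conjg !gnorm. Qed.

Lemma commgMJ u v w : [~ u, v * w] = [~ u, w] * [~ u, v] ^ w.
Proof. by rewrite /commg /conjg !gnorm. Qed.

Lemma commVgJ u v : [~ u^-1, v] = ([~ u, v]^-1) ^ u^-1.
Proof. by rewrite /commg /conjg !gnorm. Qed.

Lemma commgVJ u v : [~ u, v^-1] = ([~ u, v]^-1) ^ v^-1.
Proof. by rewrite /commg /conjg !gnorm. Qed.

Lemma commgVl u v : commute [~ u, v] u -> [~ u^-1, v] = [~ u, v]^-1.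
Proof.
move=> /conjg_commute h; have {h} := congr1 (fun w => w ^ u^-1) h.
by rewrite conjgK => ->; rewrite /commg /conjg !gnorm.
Qed.

End Commutation.

(** * From the Engel conditions to nilpotency of class 2 *)

Section EngelToClass2.
Set Implicit Arguments.
Unset Strict Implicit.
Variable G : groupType.
Implicit Types u v w x y z : G.

(** The subgroup <x, x^y> is nilpotent of class at most 2. *)
Definition conj_nil2 x y :=
  commute [~ x, x ^ y] x /\ commute [~ x, x ^ y] (x ^ y).

Lemma conj_nil2J x y z : conj_nil2 x y -> conj_nil2 (x ^ z) (y ^ z).
Proof. by case=> h1 h2; split; rewrite -conjJg -conjRg; apply: commuteJ. Qed.

(** Conjugation by y maps <x, x^(y^-1)> onto <x, x^y>. *)
Lemma conj_nil2V x y : conj_nil2 x y -> conj_nil2 x y^-1.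
Proof.
case=> h1 h2; split; apply: (@commuteJK _ _ _ y);
rewrite conjRg conjgKV -invgR; exact: commuteVl.
Qed.

(** Since [w, v] = (v^-1)^w v and right multiplication by v only conjugates
    a commutator with v, one Engel step trades w for a conjugate of v^-1. *)
Lemma engel_commg_conj (w v : G) n :
  engel_commg w v n.+2 = engel_commg (v^-1 ^ w) v n.+1 ^ v.
Proof.
elim: n => [|n IH]; first by rewrite /= /commg /conjg !gnorm.
by rewrite /= -/(engel_commg w v n.+2) IH conjRg /= conjgg.
Qed.

(** After two steps of [engel_commg_conj] two commutations with v remain, and
    the outer one says that [(v^-1)^u, v] commutes with v. *)
Lemma left_engel4_half v w : left_engel G 4 v ->
  commute [~ v^-1 ^ (v^-1 ^ w), v] v.
Proof.
move=> h; have := h w; rewrite 2!engel_commg_conj.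
move/(canRL (conjgK _)); rewrite conj1g => /(canRL (conjgK _)); rewrite conj1g.
by rewrite /= => /eqP/commgP.
Qed.

Lemma left_engel4_conj_nil2V v w : left_engel G 4 v -> left_engel G 4 v^-1 ->
  conj_nil2 v (v^-1 ^ w).
Proof.
move=> h hV; set u := v^-1 ^ w.
(* The half for v gives commutation with v, the half for v^-1, conjugated by
   u, commutation with v^u. *)
have h1 := @left_engel4_half v w h; rewrite -/u in h1.
have := @left_engel4_half v^-1 w hV; rewrite invgK => h2.
have uE : v ^ w = u^-1 by rewrite /u conjVg invgK.
rewrite uE in h2; have {h2} := @commuteJ _ _ _ u h2.
rewrite conjRg conjgKV => h2.
set t := v ^ u in h1 h2 *.
rewrite conjVg -/t in h1 h2.
have E : [~ v, t^-1] = [~ t^-1, v]^-1 by rewrite invgR.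
have h3 : commute [~ v, t^-1] v by rewrite E; apply: commuteVl.
have h4 : commute [~ v, t^-1] t.
  by rewrite -[t]invgK; apply: commuteV; rewrite invgK.
have E2 : [~ v, t] = [~ v, t^-1]^-1.
  have <- : [~ v, t^-1] ^ t = [~ v, t^-1] by apply/conjg_commute.
  by rewrite /commg /conjg !gnorm.
by split; rewrite E2; apply: commuteVl.
Qed.

(** Inverting the second entry and conjugating by g turns the pairs
    v, (v^-1)^w into all pairs of conjugates of v. *)
Lemma left_engel4_conj_nil2 v : left_engel G 4 v -> left_engel G 4 v^-1 ->
  forall g h, conj_nil2 (v ^ g) (v ^ h).
Proof.
move=> hv hV g h; have := left_engel4_conj_nil2V (h * g^-1) hv hV.
by move=> /conj_nil2V/(@conj_nil2J _ _ g); rewrite !conjVg invgK conjgM conjgKV.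
Qed.

(** The elements x and [x, y] generate the same subgroup as x and x^y. *)
Lemma conj_nil2_commg x y : conj_nil2 x y ->
  commute [~ x, y, x] x /\ commute [~ x, y, x] [~ x, y].
Proof.
have E : [~ x, x ^ y] = [~ x, y, x]^-1 by rewrite /commg /conjg !gnorm.
case; rewrite E => /commuteVl; rewrite invgK => h1 /commuteVl.
rewrite invgK => h2.
split=> //; rewrite [X in commute _ X]/commg; apply: commuteM => //.
exact: commuteV.
Qed.

End EngelToClass2.

(** * Rigidity of a geometric progression of conjugates *)

Section Progression.
Set Implicit Arguments.
Unset Strict Implicit.
Variable G : groupType.
Implicit Types (u v x y c d p q w : G) (X : set G).

(** The elements p and q measure how far d1 is from commuting with x, and d
    from commuting with x2.  The commuting of c with c1, read on x1, gives
    [d1, d] = q p; the formula for d1^y is obtained by letting x2 act on the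
    next ratio c1 c^-1 c1 of the progression.  The new factor (d q)^-1 is the
    only one that x2 can move, and d2 is fixed by x2, so q is trivial. *)
Lemma progression_collapse x x1 x2 c c1 d d1 d2 p q :
    x1 = x * c -> x2 = x1 * c1 -> commute c1 c ->
    c ^ x1 = c * d -> c1 ^ x1 = c1 * d1 -> c1 ^ x2 = c1 * d1 ->
    (c1 * c^-1 * c1) ^ x2 = c1 * c^-1 * c1 * d2 ->
    commute d c -> commute d x1 -> commute d1 x1 -> commute d1 x2 ->
    commute d2 x2 ->
    d1 ^ x = d1 * p -> commute p x -> commute p d -> commute p d1 ->
    d ^ x2 = d * q -> commute q x2 -> commute q d -> commute q d1 ->
  commute d1 x /\ d2 = d1 * d^-1 * d1.
Proof.
move=> x1E x2E c1c c_x1 c1_x1 c1_x2 c2_x2 dc dx1 d1x1 d1x2 d2x2.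
move=> d1_x px pd pd1 d_x2 qx2 qd qd1.
have fix_ u v : commute u v -> u ^ v = u by move/conjg_commute.
have d_c1 : d ^ c1 = d * q.
  by rewrite -d_x2 x2E conjgM (fix_ _ _ dx1).
have cVE : c^-1 = x1^-1 * x by rewrite x1E invgM mulgVK.
have c1E : c1 = x1^-1 * x2 by rewrite x2E mulKg.
have d1_cV : d1 ^ c^-1 = d1 * p.
  by rewrite cVE conjgM (fix_ _ _ (commuteV d1x1)).
(* This w is the commutator [d1, d]. *)
pose w := q * p.
have wE : d1 * d = d * d1 * w.
  have dE : d = [~ c, x1] by rewrite /commg c_x1 mulKg.
  have d1E : d1 = [~ c1, x1] by rewrite /commg c1_x1 mulKg.
  have x1_c1 : x1 ^ c1 = x1 * d1^-1 by rewrite d1E invgR mulVKg.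
  have x1_cV : x1 ^ c^-1 = x1 * d.
    have E : x1 ^ c = x1 * d^-1 by rewrite dE invgR mulVKg.
    apply: (canLR (conjgK c)).
    by rewrite conjMg E (fix_ _ _ dc) mulgVK.
  have : (x1 ^ c^-1) ^ c1 = (x1 ^ c1) ^ c^-1.
    by rewrite -!conjgM; congr (_ ^ _); apply/commute_sym/commuteV.
  rewrite x1_cV x1_c1 !conjMg x1_c1 x1_cV conjVg d1_cV d_c1 -!mulgA => /mulgI.
  move/(canRL (mulKg _)); rewrite invgK mulgA => E.
  have <- : d * q * (d1 * p) = d1 * d by rewrite E -mulgA mulgVK.
  by rewrite /w -!mulgA; congr (_ * _); rewrite !mulgA qd1.
have wd : commute w d by apply: commuteMl.
have wd1 : commute w d1 by apply: commuteMl.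
have wqp : w = q * p by [].
clearbody w.
have wE' : w = (d * d1)^-1 * (d1 * d) by rewrite wE mulKg.
have w_comm u : commute u d -> commute u d1 -> commute u w.
  move=> h1 h2; rewrite wE'.
  by apply: commuteM; [apply: commuteV|]; apply: commuteM.
have pw := w_comm _ pd pd1; have qw := w_comm _ qd qd1.
have x1w : commute x1 w by apply: w_comm; apply: commute_sym.
have dx : commute d x.
  by rewrite -[x](mulgK c) -x1E; apply: commuteM => //; apply: commuteV.
have wx : commute w x.
  apply/conjg_commute; apply: (mulgI p); apply: (mulgI (d * d1)).
  have := congr1 (fun u => u ^ x) wE.
  rewrite !conjMg d1_x (fix_ _ _ dx) -!mulgA pd => E.
  by rewrite -E !mulgA wE -[RHS]mulgA pw !mulgA.
have wx2 : commute w x2.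
  apply/conjg_commute; apply: (mulgI q); apply: (mulgI (d * d1)).
  have := congr1 (fun u => u ^ x2) wE.
  rewrite !conjMg d_x2 (fix_ _ _ d1x2) -!mulgA => E.
  by rewrite (mulgA d1) -qd1 -(mulgA q) -E !mulgA wE -[RHS]mulgA qw !mulgA.
have px2 : commute p x2.
  rewrite -[p](mulKg q) -wqp; apply: commuteMl => //; exact: commuteVl.
have p_x1 : p ^ x1 = w^-1 * p.
  have pE : p = d1^-1 * d1 ^ x by rewrite d1_x mulKg.
  have x_x1 : x ^ x1 = x * d^-1.
    rewrite -[x in LHS](mulgK c) -x1E conjMg conjgg conjVg c_x1 -dc invgM mulgA.
    by rewrite x1E mulgK.
  have d1_dV : d1 ^ d^-1 = d1 * w^-1.
    have E : d * d1 = d1 * (w^-1 * d) by rewrite (commuteVl wd) mulgA wE mulgK.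
    by rewrite conjgE invgK mulgA E -!mulgA mulgV mulg1.
  rewrite {1}pE conjMg conjVg conjJg (fix_ _ _ d1x1) x_x1 conjgM d1_x conjMg.
  by rewrite d1_dV (fix_ _ _ (commuteV pd)) -mulgA mulKg.
have p_x1V : p ^ x1^-1 = w * p.
  apply: (canLR (conjgK x1)).
  by rewrite conjMg p_x1 (fix_ _ _ (commute_sym x1w)) mulVKg.
have p_cV : p ^ c^-1 = w * p.
  by rewrite cVE conjgM p_x1V conjMg (fix_ _ _ wx) (fix_ _ _ px).
have p_c1 : p ^ c1 = w * p.
  by rewrite c1E conjgM p_x1V conjMg (fix_ _ _ wx2) (fix_ _ _ px2).
have d1_c1 : d1 ^ c1 = d1.
  by apply/conjg_commute; rewrite c1E; apply: commuteM => //; apply: commuteV.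
have q_cV : q ^ c^-1 = p^-1.
  rewrite -[q](mulgK p) -wqp conjMg conjVg p_cV.
  have -> : w ^ c^-1 = w.
    apply/conjg_commute; rewrite cVE; apply: commuteM => //.
    exact/commuteV/commute_sym.
  by rewrite -pw invgM mulVKg.
have c_x2 : c ^ x2 = c * (d * q).
  by rewrite x2E conjgM c_x1 conjMg d_c1 (fix_ _ _ (commute_sym c1c)).
have d2E : d2 = d1 * (w * p) * (w * p) * (d * q)^-1 * d1.
  (* Conjugation by the two halves c^-1 and c1 of c^-1 c1: the first is absorbed
     in the choice of r, the second produces the formula. *)
  have [r [h <-]] : exists r, d1 * (d * q)^-1 = r ^ c /\
      r ^ c1 * d1 = d1 * (w * p) * (w * p) * (d * q)^-1 * d1.
    exists (d1 * p * p * d^-1); split.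
      apply: (canRL (conjgKV c)).
      rewrite invgM mulgA !conjMg !conjVg d1_cV q_cV invgK.
      by rewrite (fix_ _ _ (commuteV dc)).
    by rewrite !conjMg conjVg d1_c1 p_c1 d_c1.
  apply: (mulgI (c1 * c^-1 * c1)); rewrite -c2_x2 !conjMg conjVg c1_x2 c_x2.
  by rewrite invgM -(mulgA c1) (mulgA d1) h !conjgE !gnorm.
have q1 : q = 1.
  have := d2x2 => /fix_; rewrite d2E !conjMg conjVg conjMg.
  rewrite !(fix_ _ _ d1x2) (fix_ _ _ wx2) (fix_ _ _ px2) d_x2 (fix_ _ _ qx2).
  move/mulIg/mulgI/invg_inj; rewrite -[X in _ = X]mulg1; exact/mulgI.
have wp : w = p by rewrite wqp q1 mul1g.
have p1 : p = 1.
  by have := fix_ _ _ (commute_sym x1w); rewrite wp p_x1 wp mulVg.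
split=> //; first by apply/conjg_commute; rewrite d1_x p1 mulg1.
by rewrite d2E wp p1 q1 !mulg1.
Qed.

(** From here on X stands for any set of elements, closed under conjugation and
    inversion, in which all pairs generate the class 2 subgroups above. *)
Variable X : set G.
Hypothesis XJ : forall u g, X u -> X (u ^ g).
Hypothesis XV : forall u, X u -> X u^-1.
Hypothesis Xnil2 : forall u v, X u -> X v -> conj_nil2 u v.

Section Orbit.
Variables x y : G.
Hypotheses (Xx : X x) (Xy : X y).

Local Notation c := [~ x, y].
Local Notation d := [~ x, y, x].
Local Notation c1 := (c ^ y).
Local Notation d1 := (d ^ y).
Local Notation x1 := (x ^ y).
Local Notation x2 := (x1 ^ y).

Lemma commute_d_x : commute d x.
Proof. by have [] := conj_nil2_commg (Xnil2 Xx Xy). Qed.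

Lemma commute_d_c : commute d c.
Proof. by have [] := conj_nil2_commg (Xnil2 Xx Xy). Qed.

Lemma commute_ratio_y : commute [~ c, y] y.
Proof.
have [h1 h2] := conj_nil2_commg (Xnil2 Xy Xx).
by rewrite -[c]invgR commgVl //; apply: commuteVl.
Qed.

Lemma commute_ratio_c : commute [~ c, y] c.
Proof.
have [h1 h2] := conj_nil2_commg (Xnil2 Xy Xx).
by rewrite -[c]invgR commgVl //; apply/commuteV/commuteVl.
Qed.

Lemma commute_c1_c : commute c1 c.
Proof.
have -> : c1 = c * [~ c, y] by rewrite mulVKg.
by apply: commuteMl => //; exact: commute_ratio_c.
Qed.

Lemma x1E : x1 = x * c. Proof. by rewrite mulVKg. Qed.
Lemma x2E : x2 = x1 * c1. Proof. by rewrite {1}x1E conjMg. Qed.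

Lemma commute_d_x1 : commute d x1.
Proof.
by rewrite x1E; apply: commuteM; [exact: commute_d_x|exact: commute_d_c].
Qed.

Lemma commute_d1_x1 : commute d1 x1. Proof. exact: commuteJ commute_d_x. Qed.
Lemma commute_d1_c1 : commute d1 c1. Proof. exact: commuteJ commute_d_c. Qed.
Lemma commute_d1_x2 : commute d1 x2. Proof. exact: commuteJ commute_d_x1. Qed.

Lemma conj_c_x : c ^ x = c * d. Proof. by rewrite mulVKg. Qed.
Lemma conj_c_x1 : c ^ x1 = c * d.
Proof.
have /conjg_commute d_c := commute_d_c.
by rewrite x1E conjgM conj_c_x conjMg conjgg d_c.
Qed.
Lemma conj_c1_x1 : c1 ^ x1 = c1 * d1.
Proof. by rewrite -conjJg conj_c_x conjMg. Qed.
Lemma conj_c1_x2 : c1 ^ x2 = c1 * d1.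
Proof. by rewrite -conjJg conj_c_x1 conjMg. Qed.

Lemma conj_x_x1 : x ^ x1 = x * d^-1.
Proof. by rewrite x1E conjgM conjgg invgR mulVKg. Qed.

(** The commuting of c with c1 is what makes this formula so short: it gives
    (c c1)^x1 = c1 d1 c d. *)
Lemma commg_x_x2 : [~ x, x2] = d^-1 * d1^-1.
Proof.
have h : (c * c1) ^ x1 = c1 * d1 * (c * d).
  by rewrite -commute_c1_c conjMg conj_c1_x1 conj_c_x1.
have -> : [~ x, x2] = c * ((c * c1) ^ x1)^-1 * c1.
  have {1}-> : x = x1 * c^-1 by rewrite x1E mulgK.
  by rewrite x2E; move: c c1 x1 => c' c1' x1'; rewrite /commg /conjg !gnorm.
by rewrite h -commute_d_c !gnorm.
Qed.

Local Notation p := [~ d1, x].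

(** Class 2 for <x, x^x2>, where [x, x2] = (d1 d)^-1, yields commutation with x
    and, once p commutes with d, with d1.  Commutation with d comes from a
    conjugate y' of y for which [x, y'] = c d1^-1. *)
Lemma defect_commute : [/\ commute p x, commute p d & commute p d1].
Proof.
have Xx2 : X x2 by do 2!apply: XJ.
have [h1 h2] := conj_nil2_commg (Xnil2 Xx Xx2).
have hV := commgVl h2.
have d1_x : d1 ^ x = d1 * p by rewrite mulVKg.
have kE : [~ x, x2]^-1 = d1 * d by rewrite commg_x_x2 invgM !invgK.
have pd : p ^ d = [~ x, x2, x]^-1.
  by rewrite -hV kE (commMgJ d1) (eqP (introT commgP commute_d_x)) mulg1.
have px : commute p x.
  apply: (@commuteJK _ _ _ d).
  have /commute_sym/conjg_commute -> := commute_d_x.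
  by rewrite pd; apply: commuteVl.
have dp : commute d p.
  (* Here y' = y^(x1^-1), for which x^y' = x1 d1^-1. *)
  have Xy' : X (y ^ x1^-1) by apply: XJ.
  have [h3 _] := conj_nil2_commg (Xnil2 Xx Xy').
  have E : [~ x, y ^ x1^-1] = c * d1^-1.
    have -> : [~ x, y ^ x1^-1] = x^-1 * ((x ^ x1) ^ y) ^ x1^-1.
      by rewrite -!conjgM /commg /conjg !gnorm.
    rewrite conj_x_x1 conjMg conjVg.
    have /commuteV/conjg_commute -> : commute (x1 * d1^-1) x1.
      by apply: commuteMl => //; apply/commuteVl/commute_d1_x1.
    by rewrite x1E -mulgA mulKg.
  have E2 : [~ x, y ^ x1^-1, x] = (d * p^-1) ^ d1^-1.
    by rewrite E (commMgJ c) commVgJ -conjMg.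
  rewrite E2 in h3.
  have {}h3 := commuteJ d1 h3; rewrite conjgKV in h3.
  have x_d1 : x ^ d1 = x * p^-1 by rewrite invgR mulVKg.
  rewrite x_d1 in h3.
  have h4 : commute (d * p^-1) x.
    by apply: commuteMl; [exact: commute_d_x | exact: commuteVl].
  have := commuteM (commuteV h4) h3.
  rewrite mulKg => /commuteV; rewrite invgK => h5.
  by have := commuteMl h5 (commute_refl p); rewrite mulgVK.
split=> //.
have /commute_sym h4 : commute (d1 * d) p.
  have /conjg_commute <- : commute p d by apply: commute_sym.
  by rewrite -kE pd; apply/commuteVl/commuteV/commute_sym.
have := commuteM h4 (commuteV (commute_sym dp)).
by rewrite mulgK.
Qed.

(** The ratio c^-1 c1 = [x, y, y] is fixed by y. *)
Lemma c2E : c1 ^ y = c1 * c^-1 * c1.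
Proof.
have /conjg_commute := commute_ratio_y.
rewrite [in LHS]/commg conjMg conjVg => h.
by rewrite -mulgA -[c^-1 * c1]/[~ c, y] -h mulVKg.
Qed.

End Orbit.

Section OrbitReversal.
Variables x y : G.
Hypotheses (Xx : X x) (Xy : X y).

Local Notation c := [~ x, y].
Local Notation d := [~ x, y, x].
Local Notation c1 := (c ^ y).
Local Notation d1 := (d ^ y).
Local Notation x1 := (x ^ y).
Local Notation x2 := (x1 ^ y).
Local Notation q := [~ d, x2].

(** Conjugation by y^-1 runs through the orbit backwards, from x2 to x; it
    takes d to d1^-1, d1 to d^-1 and p to [d^-1, x2]. *)
Lemma defect_commute_rev : [/\ commute q x2, commute q d & commute q d1].
Proof.
have Xx2 : X x2 by do 2!apply: XJ.
have := defect_commute Xx2 (XV Xy).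
have -> : [~ x2, y^-1] = c1^-1.
  by rewrite x2E [in LHS]/commg -x2E conjgK x2E !gnorm.
have -> : [~ c1^-1, x2] = d1^-1.
  have E : [~ c1, x2] = d1 by rewrite /commg (conj_c1_x2 Xx Xy) mulKg.
  by rewrite commVgJ E; apply/conjg_commute/commuteVl/commuteV/commute_d1_c1.
rewrite conjVg conjgK => -[h1 h2 h3].
have E : q = [~ d^-1, x2]^-1 by rewrite -(commgVl h3) invgK.
rewrite E; split; apply: commuteVl => //.
  by rewrite -[d in commute _ d]invgK; apply: commuteV.
by rewrite -[d1]invgK; apply: commuteV.
Qed.

Lemma commg4_central : commute [~ x, y, x, y] x /\ commute [~ x, y, x, y] y.
Proof.
have [px pd pd1] := defect_commute Xx Xy.
have [qx2 qd qd1] := defect_commute_rev.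
have c2_x2 : (c1 * c^-1 * c1) ^ x2 = c1 * c^-1 * c1 * d1 ^ y.
  by rewrite -c2E // -conjJg conj_c1_x1 // conjMg.
have d2x2 : commute (d1 ^ y) x2 by apply: commuteJ; apply: commute_d1_x1.
have [d1x d2E] := progression_collapse (x1E x y) (x2E x y) (commute_c1_c Xx Xy)
  (conj_c_x1 Xx Xy) (conj_c1_x1 x y) (conj_c1_x2 Xx Xy) c2_x2
  (commute_d_c Xx Xy) (commute_d_x1 Xx Xy)
  (commute_d1_x1 Xx Xy) (commute_d1_x2 Xx Xy) d2x2 (esym (mulVKg _ _)) px pd pd1
  (esym (mulVKg _ _)) qx2 qd qd1.
split.
  by apply: commuteMl => //; apply/commuteVl/commute_d_x.
by apply/conjg_commute; rewrite [in LHS]/commg conjMg conjVg d2E -mulgA mulKg.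
Qed.

End OrbitReversal.
End Progression.

(** * The upper central series of a subgroup *)

Section UpperCentral.
Set Implicit Arguments.
Unset Strict Implicit.
Variable G : groupType.
Implicit Types (g h x y : G) (A H : set G) (n k m : nat).

(** The terms are relative to H: they are subsets of H, which makes H normalise
    them. *)
Fixpoint upper_central H n : set G :=
  if n is m.+1 then
    [set g | H g /\ forall h, H h -> upper_central H m [~ g, h]]
  else [set 1].

Lemma subgroup_generated A : subgroup (generated A).
Proof.
split=> [B [[B1 _ _] _] //|u v hu hv B hB|u hu B hB].
  by case: (hB) => -[_ BM _] _; apply: BM; [apply: hu|apply: hv].
by case: (hB) => -[_ _ BV] _; apply: BV; apply: hu.
Qed.

Lemma subgroupJ H g h : subgroup H -> H g -> H h -> H (g ^ h).
Proof. by case=> _ HM HV Hg Hh; apply: (HM); [exact: HV|exact: HM]. Qed.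

Lemma subgroupR H g h : subgroup H -> H g -> H h -> H [~ g, h].
Proof.
move=> hH Hg Hh; have [_ HM HV] := hH.
by rewrite /commg; apply: HM; [exact: HV|exact: subgroupJ].
Qed.

Lemma upper_central_normal H n : subgroup H ->
  subgroup (upper_central H n) /\
  forall g h, upper_central H n g -> H h -> upper_central H n (g ^ h).
Proof.
move=> hH; have [H1 HM HV] := hH.
elim: n => [|n [[Z1 ZM ZV] ZJ]] /=.
  split; first split=> [//|u v -> ->|u ->]; rewrite ?mulg1 ?invg1 //.
  by move=> g h -> _; rewrite /= conj1g.
split; first split.
- by split=> // h _; rewrite comm1g.
- move=> u v [Hu hu] [Hv hv]; split; first exact: HM.
  by move=> h Hh; rewrite commMgJ; apply: ZM; [apply: ZJ; auto|auto].
- move=> u [Hu hu]; split; first exact: HV.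
  by move=> h Hh; rewrite commVgJ; apply: ZJ; auto.
- move=> g k [Hg hg] Hk; split; first exact: subgroupJ.
  move=> h Hh; rewrite -[h](conjgKV k) -conjRg; apply: ZJ => //.
  by apply: hg; apply: subgroupJ => //; apply: HV.
Qed.

(** The elements h of H with [g, h] in a term normalised by H form a subgroup,
    so only generators of H have to be tested. *)
Lemma upper_centralS A n g : generated A g ->
    (forall h, A h -> upper_central (generated A) n [~ g, h]) ->
  upper_central (generated A) n.+1 g.
Proof.
set H := generated A => Hg hg.
have hH : subgroup H by exact: subgroup_generated.
have [H1 HM HV] := hH.
have [[Z1 ZM ZV] ZJ] := upper_central_normal n hH.
split=> // h Hh.
suff: [set k | H k /\ upper_central H n [~ g, k]] h by case.
apply: Hh; split; last first.
  by move=> k Ak; split; [exact: sub_gen_smallest|exact: hg].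
split=> [|u v [Hu hu] [Hv hv]|u [Hu hu]].
- by split=> //; rewrite commg1.
- by split; [exact: HM|rewrite commgMJ; apply: ZM => //; exact: ZJ].
- by split; [exact: HV|rewrite commgVJ; apply: ZJ; auto].
Qed.

Lemma lower_central_sub_upper H k m : subgroup H ->
  H `<=` upper_central H (k + m) -> lower_central H k `<=` upper_central H m.
Proof.
move=> hH; elim: k m => [//|k IH] m; rewrite addSnnS => /IH {}IH /=.
apply: smallest_sub; first by have [] := upper_central_normal m hH.
by move=> _ [u /IH[_ hu]] [v Hv <-]; apply: hu.
Qed.

Lemma upper_central_nilpotent H n : subgroup H ->
  H `<=` upper_central H n -> nilpotent_class_le n H.
Proof.
move=> hH hZ; apply/seteqP; split.
  by apply: (@lower_central_sub_upper _ _ 0) => //; rewrite addn0.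
move=> _ ->; case: {hZ}n => [|n] /=; first by case: hH.
by case: (subgroup_generated [set [~ x, y] | x in lower_central H n & y in H]).
Qed.

(** The two weight 4 hypotheses start a climb through the upper central series:
    weight k commutators land in its term of index 5 - k. *)
Lemma two_generator_class4 x y :
    commute [~ x, y, x] x -> commute [~ y, x, y] y ->
    commute [~ x, y, x, y] x -> commute [~ x, y, x, y] y ->
    commute [~ y, x, y, x] x -> commute [~ y, x, y, x] y ->
  nilpotent_class_le 4 (generated [set x; y]).
Proof.
move=> dx d'y fx fy f'x f'y; set H := generated _.
have hH : subgroup H by exact: subgroup_generated.
have [H1 HM HV] := hH.
have Hx : H x by apply: sub_gen_smallest; left.
have Hy : H y by apply: sub_gen_smallest; right.
have Z1 n : upper_central H n 1 by have [[]] := upper_central_normal n hH.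
have ZV n g : upper_central H n g -> upper_central H n g^-1.
  by have [[_ _ h] _] := upper_central_normal n hH; apply: h.
have ZJ n g h : upper_central H n g -> H h -> upper_central H n (g ^ h).
  by have [_ hJ] := upper_central_normal n hH; apply: hJ.
have ZS n g : H g -> upper_central H n [~ g, x] ->
    upper_central H n [~ g, y] -> upper_central H n.+1 g.
  by move=> Hg gx gy; apply: upper_centralS => // h [] ->.
have ZC n u v : commute u v -> upper_central H n [~ u, v].
  by move/commgP/eqP=> ->.
have HR := subgroupR hH.
have f1 : upper_central H 1 [~ x, y, x, y] by apply: ZS; auto.
have f'1 : upper_central H 1 [~ y, x, y, x] by apply: ZS; auto.
have d2 : upper_central H 2 [~ x, y, x] by apply: ZS; auto.
have d'2 : upper_central H 2 [~ y, x, y] by apply: ZS; auto.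
have c3 : upper_central H 3 [~ x, y].
  apply: ZS => //; first exact: HR.
  by rewrite -[[~ x, y]]invgR commVgJ; apply: ZJ; auto.
apply: upper_central_nilpotent => //; apply: smallest_sub.
  by have [] := upper_central_normal 4 hH.
move=> _ [] ->; apply: ZS => //; rewrite ?commgg //.
by rewrite -invgR; apply: ZV.
Qed.

End UpperCentral.

(** * Nilpotency of class 4 for two conjugates *)

Theorem theorem1p5 (G : groupType) (a : G)
    (ha : left_engel G 4 a) (haV : left_engel G 4 a^-1) (b : G) :
  nilpotent_class_le 4 (generated [set a; a ^ b]).
Proof.
pose X : set G := [set u | exists g, u = a ^ g \/ u = a^-1 ^ g].
have XJ u g : X u -> X (u ^ g).
  by case=> h [] ->; exists (h * g); rewrite !conjgM; [left|right].
have XV u : X u -> X u^-1.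
  by case=> h [] ->; exists h; rewrite !conjVg ?invgK; [right|left].
have Xnil2 u v : X u -> X v -> conj_nil2 u v.
  have nil2 := left_engel4_conj_nil2 ha haV.
  have nil2V : forall g h, conj_nil2 (a^-1 ^ g) (a^-1 ^ h).
    by apply: left_engel4_conj_nil2; rewrite ?invgK.
  move=> [g [] ->] [h [] ->] //.
    by rewrite conjVg; apply: conj_nil2V.
  by rewrite -[a ^ h]invgK -conjVg; apply: conj_nil2V.
have Xa : X a by exists 1; left; rewrite conjg1.
have Xb : X (a ^ b) by exists b; left.
have [fx fy] := commg4_central XJ XV Xnil2 Xa Xb.
have [f'y f'x] := commg4_central XJ XV Xnil2 Xb Xa.
by apply: two_generator_class4 => //; apply: (commute_d_x Xnil2).
Qed.
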